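(* Let $s=a/b$ be a rational number, with $a,b$ integers and $b\neq 0$, and let $p$ be any prime not dividing $b$. Then $p$ occurs infinitely often as a factor of the numbers $S_n(s)$ for $n=1,2,3,\dots$; that is, there are infinitely many positive integers $n$ such that $p$ is a factor of the rational number $S_n(s)$.
   Context: The spread polynomials $S_n(s)$, $n=0,1,2,\dots$, are defined recursively by $S_0(s)=0$, $S_1(s)=s$, and $S_n(s)=2(1-2s)S_{n-1}(s)-S_{n-2}(s)+2s$ for $n\ge 2$. A rational number $\alpha$ is said to be divisible by a prime $p$ (equivalently, $p$ is a factor of $\alpha$) precisely when $\alpha=p\beta$ with $\beta$ a rational number which can be expressed as $\beta=c/d$ with $c$ and $d$ integers and $d$ not divisible by $p$. *)

(* Defs.v *)
From mathcomp Require Import all_boot all_order all_algebra.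
From mathcomp Require Import boolp classical_sets functions cardinality.

Set Implicit Arguments.
Unset Strict Implicit.
Unset Printing Implicit Defensive.

Import Order.TTheory GRing.Theory Num.Theory.
Local Open Scope ring_scope.

Fixpoint spread (n : nat) : {poly rat} :=
  if n is n1.+1 then
    if n1 is n2.+1 then
      2 * (1 - 2 * 'X) * spread n1 - spread n2 + 2 * 'X
    else 'X
  else 0.

(* [d] is not divisible by [p], so [d] is nonzero and [c / d] is a genuine
   quotient. *)
Definition rat_divisible_by (p : nat) (alpha : rat) : Prop :=
  exists beta : rat,
    alpha = p%:R * beta /\
    exists c d : int, ~~ (p%:Z %| d)%Z /\ beta = c%:~R / d%:~R.

(* Main.v *)
(* Modulo p the consecutive pairs (S_n, S_(n+1)) evolve under a map of F_p x F_p
   that is invertible because the coefficient of S_(n-2) in the recurrence is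
   -1. On a finite set such a map is periodic on every orbit, so the pair (0, s)
   recurs, and p divides S_n(s) for every multiple n of the period. *)
Require Import Defs.
From mathcomp Require Import all_boot all_order all_algebra.
From mathcomp Require Import boolp classical_sets functions cardinality.
From mathcomp Require Import ring.

Set Implicit Arguments.
Unset Strict Implicit.
Unset Printing Implicit Defensive.

Import Order.TTheory GRing.Theory Num.Theory.
Local Open Scope classical_set_scope.
Local Open Scope ring_scope.

(** Started at [(0, t)], the [n]-th iterate is the pair of values of $S_n$ and $S_{n+1}$ at [t]. *)
Definition spread_step (R : comPzRingType) (t : R) (x : R * R) : R * R :=
  (x.2, 2 * (1 - 2 * t) * x.2 - x.1 + 2 * t).

Lemma spread_step_inj (R : comPzRingType) (t : R) : injective (spread_step t).
Proof.
by case=> [x1 x2] [y1 y2] [-> /addIr /addrI /oppr_inj ->].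
Qed.

Lemma horner_spreadSS (s : rat) (n : nat) :
  (spread n.+2).[s] =
  2 * (1 - 2 * s) * (spread n.+1).[s] - (spread n).[s] + 2 * s.
Proof.
have horner2 : (2 : {poly rat}).[s] = 2 by rewrite -polyC_natr hornerC.
change (spread n.+2)
  with (2 * (1 - 2 * 'X) * spread n.+1 - spread n + 2 * 'X : {poly rat}).
by rewrite !(hornerE, horner2).
Qed.

(* There is no ring morphism from rat to F when F has positive characteristic,
   so reduction to F goes through the integer numerator c = b^n S_n(a/b). *)
Lemma spread_num (F : fieldType) (a b : int) (n : nat) :
  b != 0 -> b%:~R != 0 :> F ->
  exists2 c : int,
    (spread n).[a%:~R / b%:~R] = c%:~R / (b ^+ n)%:~R &
    c%:~R = b%:~R ^+ n
      * (iter n (spread_step (a%:~R / b%:~R)) (0, a%:~R / b%:~R)).1 :> F.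
Proof.
move=> b0 bF0; set t : F := _ / _; set s : rat := _ / _.
have b0Q : b%:~R != 0 :> rat by rewrite intr_eq0.
pose P m := exists2 c : int, (spread m).[s] = c%:~R / (b ^+ m)%:~R &
  c%:~R = b%:~R ^+ m * (iter m (spread_step t) (0, t)).1.
suff [] : P n /\ P n.+1 by [].
elim: n => [|n [[c cE cF] [d dE dF]]].
  split; first by exists 0; rewrite /= ?horner0 ?mul0r ?mulr0.
  by exists a; rewrite /= ?hornerX ?expr1 // /t mulrC divfK.
split; first by exists d.
have BF : (b ^+ n)%:~R = b%:~R ^+ n :> F by rewrite rmorphXn.
have B0 : (b ^+ n)%:~R != 0 :> rat by rewrite intr_eq0 expf_neq0.
(* This is the recurrence at $s = a/b$ multiplied by $b^{n+2}$ to clear denominators. *)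
exists (2 * (b - 2 * a) * d - b * b * c + 2 * a * (b * b ^+ n)).
  rewrite horner_spreadSS dE cE /s !exprS.
  move: (b ^+ n) B0 => B B0; rewrite !(intrB, intrD, intrM).
  by field; rewrite b0Q B0.
move: dF; rewrite !(intrB, intrD, intrM) BF cF !iterS => ->.
by case: (iter n _ _) => x y; rewrite /= /t !exprS; field.
Qed.

Lemma intr_Fp_eq0 (p : nat) (m : int) :
  prime p -> (m%:~R == 0 :> 'F_p) = (p%:Z %| m)%Z.
Proof. by move=> pp; rewrite (dvdz_pcharf (pchar_Fp pp)). Qed.

Theorem corollary12 (s : rat) (a b : int) (hb : b != 0)
    (hs : s = a%:~R / b%:~R) (p : nat) (hp : prime p)
    (hpb : ~~ (p%:Z %| b)%Z) :
  infinite_set [set n : nat | (0 < n)%N /\ rat_divisible_by p (spread n).[s]].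
Proof.
have bF0 : b%:~R != 0 :> 'F_p by rewrite intr_Fp_eq0.
pose t : 'F_p := a%:~R / b%:~R.
pose N := order (spread_step t) (0, t).
have N0 : (0 < N)%N by apply: order_gt0.
have iterN k : iter (k * N) (spread_step t) (0, t) = (0, t).
  elim: k => //= k IHk.
  by rewrite mulSn iterD IHk (iter_order (@spread_step_inj _ t)).
(* The successor excludes the index 0. *)
pose f k := (k.+1 * N)%N.
have f_inj : injective f.
  by move=> j k /eqP; rewrite eqn_pmul2r // eqSS => /eqP.
(* As [f] is injective, it suffices that every [f k] lies in the set. *)
move=> /(finite_preimage (f := f) (in2W f_inj)); apply: contra_not infinite_nat.
apply: sub_finite_set => k _ /=; split; first by rewrite muln_gt0.
have [c cE] := spread_num a (f k) hb bF0.
(* After whole periods the first coordinate is 0 again, so [p] divides the numerator [c]. *)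
rewrite iterN mulr0 => /eqP; rewrite intr_Fp_eq0 // => /dvdzP[e ce].
exists (e%:~R / (b ^+ f k)%:~R); split.
  by rewrite hs cE ce rmorphM /= mulrAC mulrC.
exists e, (b ^+ f k); split=> //.
by rewrite -intr_Fp_eq0 // rmorphXn expf_neq0.
Qed.
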